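(* Let $G$ and $G^*$ be graphs on the same vertex set $V=\{v_1,\dots,v_n\}$ with adjacency matrices $A$ and $A^*$, and let $S,S^*\subseteq V$ be non-empty with $W^S_G=W^{S^*}_{G^*}$. If this walk matrix has rank $n$, then $A=A^*$. (That is, a walk matrix of rank $n$ determines the adjacency matrix.)
   Context: Graphs are finite, simple, undirected. For a graph $G$ with vertex set $V=\{v_1,\dots,v_n\}$, adjacency matrix $A$, and non-empty $S\subseteq V$ with characteristic vector ${\rm e}\in\{0,1\}^n$, the walk matrix is $W^S_G=[{\rm e},A{\rm e},\dots,A^{n-1}{\rm e}]$. *)

(* Defs.v *)
From HB Require Import structures.
From mathcomp Require Import all_boot all_order all_algebra.

Set Implicit Arguments.
Unset Strict Implicit.
Unset Printing Implicit Defensive.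

Import Order.TTheory GRing.Theory Num.Theory.
Local Open Scope ring_scope.

(* The ordinal i : 'I_n stands for the vertex v_(i+1). *)
Record sgraph (n : nat) := SGraph {
  edge :> rel 'I_n;
  edge_sym : symmetric edge;
  edge_irr : irreflexive edge
}.

(* All matrices are 0-1 or integer matrices; they are given rational entries
   so that \rank, which needs a field, is the usual rank in characteristic 0. *)
Definition adj_mx (n : nat) (G : sgraph n) : 'M[rat]_n :=
  \matrix_(i, j) (G i j)%:R.

Definition char_vec (n : nat) (S : {set 'I_n}) : 'cV[rat]_n :=
  \col_i (i \in S)%:R.

Definition walk_mx (n : nat) (G : sgraph n) (S : {set 'I_n}) : 'M[rat]_n :=
  \matrix_(i, j) (adj_mx G ^+ j *m char_vec S) i 0.

(* Main.v *)
(** Let [D] be the difference of the adjacency matrices and [W] the common walk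
    matrix. Multiplication by either adjacency matrix shifts the columns of [W],
    so [D W] vanishes outside its last column, and [D = (D W) W^-1] is an outer
    product [d u^T]. As [D] is symmetric with zero diagonal,
    [D_ij ^ 2 = D_ij D_ji = D_ii D_jj = 0]. *)
Require Import Defs.
From HB Require Import structures.
From mathcomp Require Import all_boot all_order all_algebra.

Set Implicit Arguments.
Unset Strict Implicit.
Unset Printing Implicit Defensive.

Import Order.TTheory GRing.Theory Num.Theory.
Local Open Scope ring_scope.

Lemma col_walk_mx n (G : sgraph n) (S : {set 'I_n}) (j : 'I_n) :
  col j (walk_mx G S) = adj_mx G ^+ j *m char_vec S.
Proof. by apply/colP => i; rewrite !mxE. Qed.

(** Taking the successor index as an ordinal [k] excludes the last column, whose shift leaves the
    matrix. *)
Lemma mul_adj_walk_mx n (G : sgraph n) (S : {set 'I_n}) (i j k : 'I_n) :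
  k = j.+1 :> nat -> (adj_mx G *m walk_mx G S) i j = walk_mx G S i k.
Proof.
have col_i0 (M : 'M[rat]_n) l : col l M i 0 = M i l by rewrite mxE.
by move=> kE; rewrite -!col_i0 colE -mulmxA -colE !col_walk_mx kE exprS -mulmxE mulmxA.
Qed.

Lemma outer_sym_diag0_eq0 (R : idomainType) n (D : 'M[R]_n) (d u : 'I_n -> R) :
  (forall i j, D i j = d i * u j) -> D^T = D -> (forall i, D i i = 0) -> D = 0.
Proof.
move=> DE symD diagD; apply/matrixP => i j; rewrite [RHS]mxE.
apply/eqP; rewrite -sqrf_eq0 expr2 -{2}symD mxE !DE mulrACA.
by rewrite [u j * _]mulrC mulrACA -!DE diagD mul0r.
Qed.

Theorem theorem5p1 (n : nat) (G Gstar : sgraph n) (S Sstar : {set 'I_n})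
    (S_neq0 : S != set0) (Sstar_neq0 : Sstar != set0)
    (eqW : walk_mx G S = walk_mx Gstar Sstar)
    (rankW : \rank (walk_mx G S) = n) :
  adj_mx G = adj_mx Gstar.
Proof.
(* A last column [ord_max] exists only in positive dimension. *)
case: n => [|n] in G Gstar S Sstar S_neq0 Sstar_neq0 eqW rankW *.
  by rewrite [LHS]flatmx0 [RHS]flatmx0.
set W := walk_mx G S in eqW rankW.
have Wunit : W \in unitmx by rewrite -row_full_unit /row_full rankW.
apply/eqP; rewrite -subr_eq0; apply/eqP; set D := _ - _.
have DW0 i (j : 'I_n.+1) : j != ord_max -> (D *m W) i j = 0.
  move=> jNmax; have jn : (j.+1 < n.+1)%N.
    by rewrite ltn_neqAle (ltn_ord j) andbT eqSS.
  (* In the [Gstar] term, [W] is read as the walk matrix of [Gstar], so both products shift to the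
     same entry. *)
  rewrite mulmxBl mxE [(- (_ *m _)) i j]mxE {2}eqW.
  by rewrite !(@mul_adj_walk_mx _ _ _ _ _ (Ordinal jn)) // -/W eqW subrr.
(* The factors are the last column of [D *m W] and the last row of [invmx W]. *)
apply: (@outer_sym_diag0_eq0 _ _ _ (fun i => (D *m W) i ord_max)
                                   (invmx W ord_max)).
- move=> i j; rewrite -{1}[D](mulmxK Wunit) mxE (bigD1 ord_max) //=.
  by rewrite big1 ?addr0 // => k kNmax; rewrite DW0 ?mul0r.
- by apply/matrixP => i j; rewrite !mxE ![_ j i]edge_sym.
- by move=> i; rewrite !mxE !edge_irr subrr.
Qed.
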